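(* Let $\mathfrak g$ be a simple finite-dimensional complex Lie algebra, $\mathfrak k\subset\mathfrak g$ a subalgebra reductive in $\mathfrak g$ with decomposition $\mathfrak k=\bigoplus_j\mathfrak k_j$ into its center $\mathfrak k_0$ and simple ideals $\mathfrak k_j$ ($j\ge1$), let $\mathfrak p$ be the orthocomplement of $\mathfrak k$ in $\mathfrak g$ with respect to the invariant form, let $k\in\mathbb C$, and let $k_j$ be the level induced by $k$ on $\mathfrak k_j$. Assume that there is a central element $s\in\bigotimes_jV^{k_j}(\mathfrak k_j)$ that is not a scalar multiple of $\mathbf 1$ and such that, in $V^k(\mathfrak g)$, $$s_{(n)}v=0\quad\text{for all } v\in\mathfrak p \text{ and } n\ge1 .$$ Then $s=0$ in $V_k(\mathfrak g)$. Moreover, there is a non-trivial homomorphism of vertex algebras $$\Phi^{(s)}:\Big(\bigotimes_jV^{k_j}(\mathfrak k_j)\Big)\Big/\langle s\rangle\longrightarrow V_k(\mathfrak g).$$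
   Context: $(\cdot,\cdot)$ is the normalized invariant form on $\mathfrak g$ (long roots have square length $2$). $V^k(\mathfrak g)$ is the universal affine vertex algebra of level $k$, $V_k(\mathfrak g)$ its simple quotient, $\mathbf 1$ the vacuum vector. For $j\ge1$ the level $k_j$ is defined by $k(\cdot,\cdot)|_{\mathfrak k_j\times\mathfrak k_j}=k_j(\cdot,\cdot)_j$, with $(\cdot,\cdot)_j$ the normalized invariant form of $\mathfrak k_j$; for $j=0$ use $(\cdot,\cdot)_0=(\cdot,\cdot)|_{\mathfrak k_0\times\mathfrak k_0}$ and $k_0=k$. The inclusion $\mathfrak k\subset\mathfrak g$ induces a vertex algebra homomorphism $\bigotimes_jV^{k_j}(\mathfrak k_j)\to V^k(\mathfrak g)$, $x_{(-1)}\mathbf 1\mapsto x_{(-1)}\mathbf 1$, and hence one to $V_k(\mathfrak g)$; $s$ is also used to denote its images. An element $v\in\mathfrak p$ is identified with $v_{(-1)}\mathbf 1$. Central means $a_{(n)}s=0$ for all $a$ in the vertex algebra $\bigotimes_jV^{k_j}(\mathfrak k_j)$ and all $n\ge0$. $\langle s\rangle$ is the vertex algebra ideal generated by $s$.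
   Formalization: The formal theorem adds two hypotheses needed for truth: s has no component along the vacuum (it lies in the span of positive conformal weights), and the invariant form is nondegenerate on 𝔨, so that 𝔤 = 𝔨 ⊕ 𝔭. *)

(* Defs.v *)
From HB Require Import structures.
From mathcomp Require Import all_boot all_order all_algebra.
From mathcomp Require Import generic_quotient ring_quotient.
From mathcomp Require Import boolp classical_sets reals.
From mathcomp Require Export complex.

Set Implicit Arguments.
Unset Strict Implicit.
Unset Printing Implicit Defensive.

Import Order.TTheory GRing.Theory Num.Theory.
Local Open Scope ring_scope.
Local Open Scope classical_set_scope.

HB.mixin Record Vector_isLie (F : fieldType) L of Vector F L := {
  lbr : L -> L -> L;
  lbr_linearl : forall (c : F) x y z,
    lbr (c *: x + y) z = c *: lbr x z + lbr y z;
  lbr_linearr : forall (c : F) x y z,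
    lbr z (c *: x + y) = c *: lbr z x + lbr z y;
  lbr_alt : forall x, lbr x x = 0;
  lbr_jacobi : forall x y z,
    lbr x (lbr y z) + lbr y (lbr z x) + lbr z (lbr x y) = 0
}.

#[short(type="lieAlgType")]
HB.structure Definition LieAlgebra (F : fieldType) :=
  {L of Vector_isLie F L & Vector F L}.

Section Lie.
Variables (F : fieldType) (g : lieAlgType F).
Implicit Types a k m : {vspace g}.

Definition is_subalgebra a := forall x y, x \in a -> y \in a -> lbr x y \in a.

Definition is_ideal_of k a :=
  (a <= k)%VS /\ forall x y, x \in k -> y \in a -> lbr x y \in a.

Definition is_center_of k a :=
  forall x, x \in a <-> x \in k /\ (forall y, y \in k -> lbr x y = 0).

Definition simple_lie :=
  (exists x y : g, lbr x y != 0) /\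
  (forall a, is_ideal_of fullv a -> a = 0%VS \/ a = fullv).

(* reductive in g: g is a semisimple module under ad k *)
Definition reductive_in k :=
  forall m, (forall x y, x \in k -> y \in m -> lbr x y \in m) ->
  exists m', [/\ forall x y, x \in k -> y \in m' -> lbr x y \in m',
                 (m + m')%VS = fullv & (m :&: m')%VS = 0%VS].

Definition toral (h : {vspace g}) :=
  (forall x y, x \in h -> y \in h -> lbr x y = 0) /\
  (forall x, x \in h -> exists2 e : seq g, <<e>>%VS = fullv &
     forall v, v \in e -> exists c : F, lbr x v = c *: v).

(* for semisimple g these are the Cartan subalgebras *)
Definition maximal_toral (h : {vspace g}) :=
  toral h /\ forall h', toral h' -> (h <= h')%VS -> h' = h.

Definition invariant_form (B : g -> g -> F) :=
  [/\ forall (c : F) x y z, B (c *: x + y) z = c * B x z + B y z,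
      forall x y, B x y = B y x
    & forall x y z, B (lbr x y) z = B x (lbr y z)].

(* t is the element of h that represents a root alpha through the form:
   alpha = B t on h; the form carried over to the dual of h is then
   (alpha, beta) = B t_alpha t_beta *)
Definition represents_root (B : g -> g -> F) (h : {vspace g}) (t : g) :=
  [/\ t \in h, t != 0 &
      exists2 e : g, e != 0 & forall x, x \in h -> lbr x e = B t x *: e].

Definition orthocomplement (B : g -> g -> F) k (v : g) :=
  forall x, x \in k -> B v x = 0.

Definition nondegenerate_on (B : g -> g -> F) k :=
  forall x, x \in k -> orthocomplement B k x -> x = 0.

End Lie.

(* the long roots have square length 2 *)
Definition normalized_form (F : numFieldType) (g : lieAlgType F)
    (B : g -> g -> F) :=
  invariant_form B /\
  exists2 h : {vspace g}, maximal_toral h &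
    (exists2 t, represents_root B h t & B t t = 2) /\
    (forall t, represents_root B h t -> B t t <= 2).

Definition sub_lie (F : fieldType) (g : lieAlgType F) (a : {vspace g})
  (sub_a : is_subalgebra a) : Type := subvs_of a.

Section SubLie.
Variables (F : fieldType) (g : lieAlgType F) (a : {vspace g}).
Variable sub_a : is_subalgebra a.
Local Notation T := (sub_lie sub_a).

HB.instance Definition _ := Vector.copy T (subvs_of a).

Definition sub_lbr (x y : T) : T := vsproj a (lbr (vsval x) (vsval y)).

Lemma vsval_lbr (x y : T) : vsval (sub_lbr x y) = lbr (vsval x) (vsval y).
Proof. by rewrite vsprojK // sub_a // subvsP. Qed.

Fact sub_lbr_linearl (c : F) x y z :
  sub_lbr (c *: x + y) z = c *: sub_lbr x z + sub_lbr y z.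
Proof.
by apply: val_inj; rewrite /= vsval_lbr linearP lbr_linearl -!vsval_lbr -linearP.
Qed.

Fact sub_lbr_linearr (c : F) x y z :
  sub_lbr z (c *: x + y) = c *: sub_lbr z x + sub_lbr z y.
Proof.
by apply: val_inj; rewrite /= vsval_lbr linearP lbr_linearr -!vsval_lbr -linearP.
Qed.

Fact sub_lbr_alt x : sub_lbr x x = 0.
Proof. by apply: val_inj; rewrite /= vsval_lbr lbr_alt. Qed.

Fact sub_lbr_jacobi x y z :
  sub_lbr x (sub_lbr y z) + sub_lbr y (sub_lbr z x) + sub_lbr z (sub_lbr x y)
  = 0.
Proof.
apply: val_inj; rewrite /= !vsval_lbr.
exact: lbr_jacobi.
Qed.

HB.instance Definition _ := Vector_isLie.Build F T
  sub_lbr_linearl sub_lbr_linearr sub_lbr_alt sub_lbr_jacobi.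

End SubLie.

(* 'C(m, j) for an integer m *)
Definition binz (m : int) (j : nat) : int :=
  match m with
  | Posz p => 'C(p, j)%:Z
  | Negz p => (-1) ^+ j * 'C(p + j, j)%:Z
  end.

(* nprod a n b is the n-th product a_(n) b. The Borcherds identity reads
     sum_(j >= 0) 'C(m, j) (a_(n+j) b)_(m+k-j) c
     = sum_(j >= 0) (-1)^j 'C(n, j)
         (a_(m+n-j) (b_(k+j) c) - (-1)^n b_(n+k-j) (a_(m+j) c));
   by truncation the two sums have finitely many nonzero terms, hence the
   partial sums are eventually constant. *)
HB.mixin Record Lmodule_isVertexAlgebra (F : fieldType) V
    of GRing.Lmodule F V := {
  vac : V;
  nprod : V -> int -> V -> V;
  nprod_linearl : forall (c : F) a a' n b,
    nprod (c *: a + a') n b = c *: nprod a n b + nprod a' n b;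
  nprod_linearr : forall (c : F) a n b b',
    nprod a n (c *: b + b') = c *: nprod a n b + nprod a n b';
  nprod_trunc : forall a b, exists N : int, forall n : int, N <= n ->
    nprod a n b = 0;
  nprod_vacl : forall n a, nprod vac n a = if n == -1 then a else 0;
  nprod_vacrN1 : forall a, nprod a (-1) vac = a;
  nprod_vacr : forall a (n : int), 0 <= n -> nprod a n vac = 0;
  borcherds : forall a b c (m n k : int), exists N0 : nat,
    forall N : nat, (N0 <= N)%N ->
    \sum_(j < N) nprod (nprod a (n + j%:Z) b) (m + k - j%:Z) c *~ binz m j =
    \sum_(j < N)
      (nprod a (m + n - j%:Z) (nprod b (k + j%:Z) c)
       - nprod b (n + k - j%:Z) (nprod a (m + j%:Z) c) *~ ((-1) ^+ `|n|%N))
      *~ ((-1) ^+ j * binz n j)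
}.

#[short(type="vertexAlgType")]
HB.structure Definition VertexAlgebra (F : fieldType) :=
  {V of Lmodule_isVertexAlgebra F V & GRing.Lmodule F V}.

Definition va_hom (F : fieldType) (V W : vertexAlgType F) (f : V -> W) :=
  [/\ linear f, f vac = vac & forall a n b, f (nprod a n b) = nprod (f a) n (f b)].

Section VertexAlgebra.
Variables (F : fieldType) (V : vertexAlgType F).

Definition va_ideal (I : set V) :=
  [/\ I 0, forall (c : F) u v, I u -> I v -> I (c *: u + v)
    & forall a n v, I v -> I (nprod a n v) /\ I (nprod v n a)].

Definition va_ideal_gen (S : set V) : set V :=
  [set v | forall I, va_ideal I -> S `<=` I -> I v].

Definition simple_va :=
  vac != 0 :> V /\
  forall I, va_ideal I -> (forall v, I v -> v = 0) \/ (forall v, I v).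

Definition central (s : V) := forall a (n : int), 0 <= n -> nprod a n s = 0.

Inductive lspan (S : set V) : set V :=
| lspan0 : lspan S 0
| lspanZD (c : F) u v : S u -> lspan S v -> lspan S (c *: u + v).

(* monomial G n : the vectors g1_(-n1) ... gr_(-nr) 1 with gi in G, ni >= 1
   and n1 + ... + nr = n *)
Inductive monomial (G : set V) : nat -> set V :=
| monomial_vac : monomial G 0 vac
| monomial_cons p n x v : G x -> monomial G n v ->
    monomial G (p.+1 + n) (nprod x (- p.+1%:Z) v).

(* the subspace of conformal weight n, for G the image of a Lie algebra in its
   affine vertex algebra *)
Definition weight_space (G : set V) (n : nat) : set V := lspan (monomial G n).

Definition positive_part (G : set V) : set V :=
  lspan [set v | exists n, weight_space G n.+1 v].

Definition graded_subspace (G : set V) (I : set V) :=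
  forall v, I v -> lspan [set u | I u /\ exists n, weight_space G n u] v.

End VertexAlgebra.

Section Quotient.
Variables (F : fieldType) (V : vertexAlgType F) (S : set V).

Lemma va_ideal_genP : va_ideal (va_ideal_gen S).
Proof.
split=> [I [I0 _ _] _ //|c u v Iu Iv I idI SI|a n v Iv].
  by have [_ + _] := idI; apply; [apply: Iu|apply: Iv].
by split=> I idI SI; have [_ _ /(_ a n v (Iv I idI SI)) []] := idI.
Qed.

Definition in_ideal : {pred V} := fun v => `[< va_ideal_gen S v >].

Fact in_ideal_zmod : zmod_closed in_ideal.
Proof.
have [I0 IZD _] := va_ideal_genP.
split=> [|x y /asboolP Ix /asboolP Iy]; apply/asboolP => //.
by rewrite addrC -scaleN1r; apply: IZD.
Qed.
HB.instance Definition _ := GRing.isZmodClosed.Build V in_ideal in_ideal_zmod.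

Definition va_quot : Type := Quotient.quot in_ideal.
HB.instance Definition _ := GRing.Zmodule.copy va_quot (Quotient.quot in_ideal).

Definition va_pi (v : V) : va_quot := \pi_(Quotient.quot in_ideal)%qT v.

Lemma va_piP u v : va_pi u = va_pi v <-> va_ideal_gen S (u - v).
Proof.
split=> [/eqP|I_uv]; first by rewrite -Quotient.idealrBE => /asboolP.
by apply/eqP; rewrite -Quotient.idealrBE; apply/asboolP.
Qed.

Lemma va_pi_surj (x : va_quot) : exists v, va_pi v = x.
Proof. by exists (repr (x : Quotient.quot in_ideal)); rewrite /va_pi reprK. Qed.

Lemma va_piB : {morph va_pi : u v / u - v}.
Proof. by move=> u v; rewrite /va_pi [LHS]raddfB. Qed.
Lemma va_piD : {morph va_pi : u v / u + v}.
Proof. by move=> u v; rewrite /va_pi [LHS]raddfD. Qed.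
Lemma va_pi0 : va_pi 0 = 0.
Proof. by rewrite /va_pi [LHS]raddf0. Qed.

Definition va_quot_repr (x : va_quot) : V := repr (x : Quotient.quot in_ideal).
Lemma va_quot_reprK : cancel va_quot_repr va_pi.
Proof. by move=> x; rewrite /va_pi /va_quot_repr reprK. Qed.

Definition quot_scale (c : F) (x : va_quot) := va_pi (c *: va_quot_repr x).
Definition quot_vac := va_pi vac.
Definition quot_nprod (x : va_quot) n (y : va_quot) :=
  va_pi (nprod (va_quot_repr x) n (va_quot_repr y)).

Lemma va_piZ c v : va_pi (c *: v) = quot_scale c (va_pi v).
Proof.
have [I0 IZD _] := va_ideal_genP.
apply/va_piP; rewrite -scalerBr -[X in va_ideal_gen S X]addr0.
by apply: IZD => //; apply/va_piP; rewrite va_quot_reprK.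
Qed.

Lemma va_pi_nprod u n v : va_pi (nprod u n v) = quot_nprod (va_pi u) n (va_pi v).
Proof.
have [I0 IZD Inp] := va_ideal_genP.
set u' := va_quot_repr (va_pi u); set v' := va_quot_repr (va_pi v).
have Iu : va_ideal_gen S (u - u') by apply/va_piP; rewrite va_quot_reprK.
have Iv : va_ideal_gen S (v - v') by apply/va_piP; rewrite va_quot_reprK.
apply/va_piP.
have -> : nprod u n v - nprod u' n v' =
    1 *: nprod (u - u') n v + nprod u' n (v - v').
  have -> : u - u' = (-1) *: u' + u by rewrite scaleN1r addrC.
  have -> : v - v' = (-1) *: v' + v by rewrite scaleN1r addrC.
  rewrite scale1r nprod_linearl nprod_linearr !scaleN1r [- _ + nprod u n v]addrC.
  by rewrite [- _ + nprod u' n v]addrC subrKA.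
by apply: IZD; [have [_] := Inp v n _ Iu|have [] := Inp u' n _ Iv].
Qed.

Fact quot_scaleA (a b : F) x :
  quot_scale a (quot_scale b x) = quot_scale (a * b) x.
Proof. by have [v <-] := va_pi_surj x; rewrite -!va_piZ scalerA. Qed.
Fact quot_scale1 : left_id 1 quot_scale.
Proof. by move=> x; have [v <-] := va_pi_surj x; rewrite -!va_piZ scale1r. Qed.
Fact quot_scaleDr : right_distributive quot_scale +%R.
Proof.
move=> c x y; have [v <-] := va_pi_surj x; have [w <-] := va_pi_surj y.
by rewrite -va_piD -!va_piZ scalerDr va_piD.
Qed.
Fact quot_scaleDl x : {morph quot_scale^~ x : a b / a + b}.
Proof.
by move=> a b; have [v <-] := va_pi_surj x; rewrite -!va_piZ scalerDl va_piD.
Qed.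
HB.instance Definition _ := GRing.Zmodule_isLmodule.Build F va_quot
  quot_scaleA quot_scale1 quot_scaleDr quot_scaleDl.

Lemma va_pi_linear : linear va_pi.
Proof. by move=> c u v; rewrite va_piD va_piZ. Qed.
HB.instance Definition _ :=
  GRing.isLinear.Build F V va_quot *:%R va_pi va_pi_linear.

Fact quot_nprod_linearl (c : F) a a' n b :
  quot_nprod (c *: a + a') n b = c *: quot_nprod a n b + quot_nprod a' n b.
Proof.
have [u <-] := va_pi_surj a; have [u' <-] := va_pi_surj a'.
have [v <-] := va_pi_surj b.
by rewrite -linearP -!va_pi_nprod nprod_linearl linearP.
Qed.
Fact quot_nprod_linearr (c : F) a n b b' :
  quot_nprod a n (c *: b + b') = c *: quot_nprod a n b + quot_nprod a n b'.
Proof.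
have [u <-] := va_pi_surj a; have [v' <-] := va_pi_surj b'.
have [v <-] := va_pi_surj b.
by rewrite -linearP -!va_pi_nprod nprod_linearr linearP.
Qed.
Fact quot_nprod_trunc a b : exists N : int, forall n : int, N <= n ->
  quot_nprod a n b = 0.
Proof.
have [u <-] := va_pi_surj a; have [v <-] := va_pi_surj b.
have [N Nuv] := nprod_trunc u v; exists N => n Nn.
by rewrite -va_pi_nprod Nuv // linear0.
Qed.
Fact quot_nprod_vacl n a : quot_nprod quot_vac n a = if n == -1 then a else 0.
Proof.
have [u <-] := va_pi_surj a; rewrite -va_pi_nprod nprod_vacl.
by case: ifP; rewrite // linear0.
Qed.
Fact quot_nprod_vacrN1 a : quot_nprod a (-1) quot_vac = a.
Proof. by have [u <-] := va_pi_surj a; rewrite -va_pi_nprod nprod_vacrN1. Qed.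
Fact quot_nprod_vacr a (n : int) : 0 <= n -> quot_nprod a n quot_vac = 0.
Proof.
by have [u <-] := va_pi_surj a => n0; rewrite -va_pi_nprod nprod_vacr ?linear0.
Qed.
Fact quot_borcherds a b c (m n k : int) : exists N0 : nat,
  forall N : nat, (N0 <= N)%N ->
  \sum_(j < N) quot_nprod (quot_nprod a (n + j%:Z) b) (m + k - j%:Z) c
    *~ binz m j =
  \sum_(j < N)
    (quot_nprod a (m + n - j%:Z) (quot_nprod b (k + j%:Z) c)
     - quot_nprod b (n + k - j%:Z) (quot_nprod a (m + j%:Z) c)
       *~ ((-1) ^+ `|n|%N))
    *~ ((-1) ^+ j * binz n j).
Proof.
have [u <-] := va_pi_surj a; have [v <-] := va_pi_surj b.
have [w <-] := va_pi_surj c.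
have [N0 H] := borcherds u v w m n k; exists N0 => N /H /(congr1 va_pi).
rewrite !linear_sum => E; apply: etrans (etrans E _).
  by apply: eq_bigr => j _; rewrite -!va_pi_nprod raddfMz.
by apply: eq_bigr => j _; rewrite -!va_pi_nprod raddfMz raddfB raddfMz.
Qed.

HB.instance Definition _ := Lmodule_isVertexAlgebra.Build F va_quot
  quot_nprod_linearl quot_nprod_linearr quot_nprod_trunc quot_nprod_vacl
  quot_nprod_vacrN1 quot_nprod_vacr quot_borcherds.

Lemma va_pi_hom : va_hom va_pi.
Proof. by split=> [||a n b]; [apply: va_pi_linear| |apply: va_pi_nprod]. Qed.

End Quotient.

(* A module of level k over the affine Lie algebra
   g[t, t^-1] + F K, [x t^m, y t^n] = [x, y] t^(m+n) + m delta_(m,-n) (x, y) K,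
   on which x t^n acts as rho x n and K as the scalar k. *)
Definition affine_module (F : fieldType) (g : lieAlgType F)
    (form : g -> g -> F) (k : F) (M : lmodType F)
    (rho : g -> int -> M -> M) :=
  [/\ forall n v, linear (fun x => rho x n v),
      forall x n, linear (rho x n)
    & forall x y m n v,
        rho x m (rho y n v) - rho y n (rho x m v) =
        rho (lbr x y) (m + n) v +
        (if m + n == 0 then (k * form x y) *: v *~ m else 0)].

(* V is the induced module U(gaff) (x)_(U(g[t] + F K)) F_k, described by
   Frobenius reciprocity, with the vertex algebra structure in which 1 (x) 1 is
   the vacuum and the field of iota x = x_(-1) 1 is sum_n (x t^n) z^(-n-1). *)
Definition universal_affine (F : fieldType) (g : lieAlgType F)
    (form : g -> g -> F) (k : F) (V : vertexAlgType F) (iota : g -> V) :=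
  affine_module form k (fun x n (v : V) => nprod (iota x) n v) /\
  forall (M : lmodType F) (rho : g -> int -> M -> M) (w : M),
    affine_module form k rho ->
    (forall x (n : int), 0 <= n -> rho x n w = 0) ->
    exists! f : V -> M,
      [/\ linear f, f vac = w &
          forall x n v, f (nprod (iota x) n v) = rho x n (f v)].

(* At the critical level V^k(g) also has maximal ideals that are not graded;
   "the" simple quotient is the graded one. *)
Definition simple_quotient (F : fieldType) (g : lieAlgType F)
    (V : vertexAlgType F) (iota : g -> V)
    (L : vertexAlgType F) (pi : V -> L) :=
  [/\ va_hom pi, forall y, exists v, pi v = y, simple_va L
    & graded_subspace (range iota) [set v | pi v = 0]].

Section Tensor.
Variables (F : fieldType) (J : finType) (V : J -> vertexAlgType F).

Definition multilinear (M : lmodType F) (f : (forall j, V j) -> M) :=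
  forall (a : forall j, V j) (j : J) (c : F) (x y : V j),
    f (dfwith a (c *: x + y)) = c *: f (dfwith a x) + f (dfwith a y).

(* The third clause is Y(a_1 (x) a_2 (x) ..., z) = Y(a_1, z) (x) Y(a_2, z) ...:
   the coefficient of z^(-n-1) is the sum of (x)_j a_j_(i_j) b_j over the
   families i with sum_j (i_j + 1) = n + 1. If a_j_(i) b_j = 0 for all i >= N,
   only the finitely many i_j = N - 1 - d_j with d_j >= 0 contribute, and
   then sum_j d_j = #|J| N - n - 1. *)
Definition is_tensor (W : vertexAlgType F) (tau : (forall j, V j) -> W) :=
  [/\ multilinear tau /\
      (forall (M : lmodType F) (f : (forall j, V j) -> M), multilinear f ->
         exists! h : W -> M, linear h /\ forall a, h (tau a) = f a),
      tau (fun j => vac) = vac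
    & forall (a b : forall j, V j) (N : int),
        (forall j (i : int), N <= i -> nprod (a j) i (b j) = 0) ->
        forall n : int,
        nprod (tau a) n (tau b) =
        \sum_(d : {ffun J -> 'I_`|(N *+ #|J| - n)%R|}
               | \sum_j ((N - 1 - (d j)%:Z) + 1) == n + 1)
          tau (fun j => nprod (a j) (N - 1 - (d j)%:Z) (b j))].

Definition tensor_in (W : vertexAlgType F) (tau : (forall j, V j) -> W)
    (j : J) (v : V j) : W :=
  tau (dfwith (fun i => vac : V i) v).

End Tensor.

(* Main.v *)
(* Let S be the image of s in V. Centrality of s gives x_(n) S = 0 for x in kk
   and n >= 0, and skew symmetry turns S_(n) v = 0 (n >= 1) into v_(n) S = 0
   (n >= 1) for v in the orthocomplement; hence x_(n) S = 0 for all x in g and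
   n >= 1. The operators x_(n) (n <= 0) and T never lower the conformal weight,
   and the subspace they generate from S is an ideal by the commutation
   relations. As S has positive weights, this ideal does not contain the vacuum
   even modulo the graded kernel of pi, so its image in the simple quotient is
   zero. The composite pi o theta then factors through the ideal generated by
   s and preserves the vacuum. *)
From HB Require Import structures.
Require Import Defs.
From mathcomp Require Import all_boot all_order all_algebra.
From mathcomp Require Import boolp classical_sets functions reals complex.

Set Implicit Arguments.
Unset Strict Implicit.
Unset Printing Implicit Defensive.

Import Order.TTheory GRing.Theory Num.Theory.
Local Open Scope ring_scope.
Local Open Scope classical_set_scope.

(** * Linear subspaces given as sets *)

Definition subspace (F : fieldType) (M : lmodType F) (U : set M) :=
  U 0 /\ forall (c : F) u v, U u -> U v -> U (c *: u + v).

Section Subspace.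
Variables (F : fieldType) (M : lmodType F) (U : set M).
Hypothesis U_sub : subspace U.

Lemma subspaceZ c u : U u -> U (c *: u).
Proof. by have [U0 UZD] := U_sub => Uu; rewrite -[_ *: _]addr0; apply: UZD. Qed.

Lemma subspaceD u v : U u -> U v -> U (u + v).
Proof. by have [_ UZD] := U_sub => Uu Uv; rewrite -[u]scale1r; apply: UZD. Qed.

Lemma subspaceB u v : U u -> U v -> U (u - v).
Proof.
by move=> Uu Uv; apply: subspaceD => //; rewrite -scaleN1r; apply: subspaceZ.
Qed.

Lemma subspaceMz u m : U u -> U (u *~ m).
Proof. by move=> Uu; rewrite -scaler_int; apply: subspaceZ. Qed.

Lemma subspace_sum (I : finType) (f : I -> M) :
  (forall i, U (f i)) -> U (\sum_i f i).
Proof.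
by move=> Uf; elim/big_ind: _ => //; [case: U_sub|apply: subspaceD].
Qed.

(** Carrying the proof as an argument lets the submodule structure be inferred, so that
    [subspace_type] is a module to which a universal property applies. *)
Definition subspace_pred (_ : subspace U) : {pred M} := fun v => `[< U v >].

Fact subspace_pred_closed : submod_closed (subspace_pred U_sub).
Proof.
have [U0 UZD] := U_sub.
by split=> [|c u v /asboolP Uu /asboolP Uv]; apply/asboolP => //; apply: UZD.
Qed.
HB.instance Definition _ :=
  GRing.isSubmodClosed.Build F M (subspace_pred U_sub) subspace_pred_closed.

Record subspace_type := SubspaceType {
  subspace_val : M; _ : subspace_val \in subspace_pred U_sub }.
HB.instance Definition _ := [isSub for subspace_val].
HB.instance Definition _ := [Choice of subspace_type by <:].
HB.instance Definition _ := [SubChoice_isSubLmodule of subspace_type by <:].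

End Subspace.

(** * Consequences of the Borcherds identity *)

Section VertexAlgebraTheory.
Variables (F : numFieldType) (V : vertexAlgType F).
Implicit Types (a b u v w : V) (n m : int).

HB.instance Definition _ a n :=
  GRing.isLinear.Build F V V *:%R (nprod a n)
    (fun c u v => nprod_linearr c a n u v).

Lemma nprod0l n b : nprod 0 n b = 0.
Proof. by have := nprod_linearl (-1) b b n b; rewrite !scaleN1r !addNr. Qed.

Lemma binz0 m : binz m 0 = 1.
Proof. by case: m => p /=; rewrite ?bin0 ?mulr1. Qed.

Lemma binz1 m : binz m 1 = m.
Proof. by case: m => p /=; rewrite bin1 // addn1 mulN1r NegzE. Qed.

Lemma binz_m1 j : binz (-1) j = (-1) ^+ j.
Proof. by rewrite /binz /= binn mulr1. Qed.

Lemma binz_0 j : binz 0 j = (j == 0%N)%:Z.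
Proof. by case: j. Qed.

(* The Borcherds identity at [c = vac, m = -1, k = 0], where
   [nprod x (- 1 - j) vac] is the divided power [T^j x / j!]. *)
Lemma nprod_skew a b n : exists N : nat,
  nprod b n a = - ((\sum_(j < N) nprod (nprod a (n + j%:Z) b) (- 1 - j%:Z) vac
     *~ (-1) ^+ j) *~ (-1) ^+ `|n|%N).
Proof.
have [N /(_ N.+1 (leqnSn N)) E] := borcherds a b vac (-1) n 0.
exists N.+1; move: E; rewrite [RHS]big_ord_recl [X in _ = _ + X]big1 => [|j _].
  rewrite !addr0 nprod_vacr // linear0 sub0r nprod_vacrN1 binz0 !mulr1z.
  under eq_bigr do rewrite binz_m1.
  by move=> ->; rewrite mulNrz opprK -mulrzA -expr2 sqrr_sign mulr1z.
rewrite !nprod_vacr ?linear0 ?mul0rz ?subr0 ?mul0rz //.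
Qed.

(** The Borcherds identity at [c = vac], [m = 0], [k = -2], where only j = 0 on the left and j = 0,
    1 on the right survive. For T u = u_(-2) 1 it reads [T, a_(n)] = -n a_(n-1). *)
Lemma nprod_derivation a n b :
  nprod (nprod a n b) (-2) vac =
  nprod a n (nprod b (-2) vac) - nprod a (n - 1) b *~ n.
Proof.
have [N /(_ N.+2) E] := borcherds a b vac 0 n (-2).
have {E} := E (leq_trans (leqnSn N) (leqnSn _)).
rewrite [X in X = _ -> _]big_ord_recl.
rewrite [X in _ + X = _ -> _]big1 => [|j _]; last first.
  by rewrite binz_0 mulr0z.
rewrite 2!big_ord_recl big1 => [|j _]; last first.
  by rewrite !nprod_vacr ?linear0 ?mul0rz ?subr0 ?mul0rz.
rewrite (_ : lift ord0 ord0 = 1%N :> nat) // (_ : (-2) + 1%:Z = -1) //.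
rewrite !addr0 !binz0 binz1 mul1r expr1 mulN1r !mulr1z !add0r.
rewrite nprod_vacrN1 (nprod_vacr a 0) // (nprod_vacr a 1) //.
by rewrite !linear0 !mul0rz !subr0 mulrNz.
Qed.

Lemma nprod_vac_m2 : nprod vac (-2) vac = 0 :> V.
Proof. by rewrite nprod_vacl. Qed.

(** By [nprod_derivation] at [b = vac], T (u_(-1-j) 1) = (j+1) u_(-2-j) 1, and j+1 is invertible in
    a [numFieldType]. *)
Lemma nprod_vac_closed (U : set V) :
  subspace U -> (forall u, U u -> U (nprod u (-2) vac)) ->
  forall u (j : nat), U u -> U (nprod u (- 1 - j%:Z) vac).
Proof.
move=> U_sub UT u j Uu; elim: j => [|j IHj].
  by rewrite subr0 nprod_vacrN1.
have := UT _ IHj; rewrite nprod_derivation nprod_vac_m2 linear0 sub0r.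
have -> : - 1 - j%:Z - 1 = - 1 - j.+1%:Z by rewrite -addn1 PoszD opprD addrA.
have -> : - 1 - j%:Z = - (j.+1)%:Z by rewrite -add1n PoszD opprD.
rewrite mulrNz opprK -pmulrn -scaler_nat => /(subspaceZ U_sub (j.+1%:R^-1)).
by rewrite scalerA mulVf ?pnatr_eq0 // scale1r.
Qed.

(** With its first index 0, the Borcherds identity expands a mode of a_(n) b on [u] into finitely
    many products of a mode of [a] and a mode of [b]. *)
Lemma nprod_iterate_closed (U : set V) a b : subspace U ->
  (forall n u, U u -> U (nprod a n u)) ->
  (forall n u, U u -> U (nprod b n u)) ->
  forall n m u, U u -> U (nprod (nprod a n b) m u).
Proof.
move=> U_sub Ua Ub n m u Uu.
have [N /(_ N.+1 (leqnSn N))] := borcherds a b u 0 n m.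
rewrite [X in X = _ -> _]big_ord_recl.
rewrite [X in _ + X = _ -> _]big1 => [|j _]; last first.
  by rewrite binz_0 mulr0z.
rewrite !addr0 binz0 mulr1z add0r => ->.
apply: subspace_sum => // j; apply: subspaceMz => //; apply: subspaceB => //.
  by apply/Ua/Ub.
by apply: subspaceMz => //; apply/Ub/Ua.
Qed.

(** Skew symmetry writes u_(n) a as a combination of the vectors T^j (a_(n+j) u) / j!. *)
Lemma left_ideal_va_ideal (U : set V) :
  subspace U -> (forall u, U u -> U (nprod u (-2) vac)) ->
  (forall a n u, U u -> U (nprod a n u)) -> va_ideal U.
Proof.
move=> U_sub UT Ul; case: (U_sub) => U0 UZD; split=> // a n u Uu; split.
  exact: Ul.
have [N ->] := nprod_skew a u n; rewrite -mulrNz.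
apply: subspaceMz => //; apply: subspace_sum => // j; apply: subspaceMz => //.
by apply: nprod_vac_closed => //; apply: Ul.
Qed.

Lemma lspan_subspace (S : set V) : subspace (lspan S).
Proof.
split=> [|c u v + Sv]; first exact: lspan0.
elim=> [|d w x Sw _ IH]; first by rewrite scaler0 add0r.
by rewrite scalerDr scalerA -addrA; apply: lspanZD.
Qed.

Lemma mem_lspan (S : set V) u : S u -> lspan S u.
Proof.
move=> Su; rewrite -[u]scale1r -[_ *: _]addr0.
by apply: lspanZD => //; apply: lspan0.
Qed.

Lemma lspan_sub (S U : set V) : subspace U -> S `<=` U -> lspan S `<=` U.
Proof.
by move=> [U0 UZD] SU u; elim=> // c v w Sv _; apply: UZD; apply: SU.
Qed.

End VertexAlgebraTheory.

(** * Kernels, images and weights under homomorphisms *)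

Section Hom.
Variables (F : numFieldType) (V W : vertexAlgType F) (f : V -> W).
Hypothesis f_hom : va_hom f.

Lemma va_hom0 : f 0 = 0.
Proof. by have [/(_ (-1) 0 0)] := f_hom; rewrite !scaleN1r !addNr. Qed.

Lemma va_hom_ker_ideal : va_ideal [set v | f v = 0].
Proof.
have [f_lin _ fE] := f_hom.
split=> //= [|c u v fu fv|a n v fv]; first exact: va_hom0.
  by rewrite f_lin fu fv scaler0 addr0.
by rewrite !fE fv linear0 nprod0l.
Qed.

Lemma va_hom_image_ideal (I : set V) :
  (forall y, exists v, f v = y) -> va_ideal I -> va_ideal (f @` I).
Proof.
have [f_lin _ fE] := f_hom => f_surj [I0 IZD In].
split=> [|c _ _ [u Iu <-] [v Iv <-]|y n _ [v Iv <-]].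
- by exists 0 => //; apply: va_hom0.
- by exists (c *: u + v); [apply: IZD|apply: f_lin].
have [a <-] := f_surj y; have [Ian Ina] := In a n v Iv.
by rewrite -!fE; split; [exists (nprod a n v)|exists (nprod v n a)].
Qed.

Lemma va_hom_lspan (S : set V) (U : set W) :
  subspace U -> (forall v, S v -> U (f v)) -> forall v, lspan S v -> U (f v).
Proof.
have [f_lin _ _] := f_hom => -[U0 UZD] SU v.
elim=> [|c u w Su _ IH]; first by rewrite va_hom0.
by rewrite f_lin; apply: UZD => //; apply: SU.
Qed.

Lemma va_hom_weight_space (G : set V) (H : set W) n v :
  (forall x, G x -> H (f x)) -> weight_space G n v -> weight_space H n (f v).
Proof.
have [_ fvac fE] := f_hom => GH.
apply: va_hom_lspan; first exact: lspan_subspace.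
move=> {}v mv; apply: mem_lspan; elim: mv => [|p m x u Gx _ IH].
  by rewrite fvac; apply: monomial_vac.
by rewrite fE; apply: monomial_cons => //; apply: GH.
Qed.

Lemma va_hom_positive_part (G : set V) (H : set W) v :
  (forall x, G x -> H (f x)) -> positive_part G v -> positive_part H (f v).
Proof.
move=> GH; apply: va_hom_lspan; first exact: lspan_subspace.
move=> u [n Gu]; apply: mem_lspan; exists n; exact: va_hom_weight_space Gu.
Qed.

End Hom.

(** * The universal affine vertex algebra and its weights *)

Section Affine.
Variables (F : numFieldType) (g : lieAlgType F) (form : g -> g -> F) (k : F).
Variables (V : vertexAlgType F) (iota : g -> V).
Hypothesis V_univ : universal_affine form k iota.
Implicit Types (x y : g) (u v w : V) (n m : int).

Lemma affine_commute x y m n v :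
  nprod (iota x) m (nprod (iota y) n v) =
  nprod (iota y) n (nprod (iota x) m v) + nprod (iota (lbr x y)) (m + n) v +
  (if m + n == 0 then (k * form x y) *: v *~ m else 0).
Proof. by have [[_ _ comm] _] := V_univ; rewrite -addrA -comm addrC subrK. Qed.

Lemma iota_linear : linear iota.
Proof.
have [[lin _ _] _] := V_univ => c x y.
by have := lin (-1) vac c x y; rewrite !nprod_vacrN1.
Qed.

(* Both [id] and the map into [U] given by the universal property extend
   [vac |-> vac], so they agree. *)
Lemma affine_ind (U : set V) : subspace U -> U vac ->
  (forall x n u, U u -> U (nprod (iota x) n u)) -> forall v, U v.
Proof.
move=> U_sub Uvac Ux v; have [[linl _ comm] univ] := V_univ.
have UP (u : subspace_type U_sub) : U (val u) by case: u => u /= /asboolP.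
pose mk u (Uu : U u) : subspace_type U_sub :=
  SubspaceType (introT (asboolP _) Uu).
pose rho x n (u : subspace_type U_sub) := mk _ (Ux x n _ (UP u)).
have rho_aff : affine_module form k rho.
  split=> [n u c a b|x n c u w|x y m n u]; apply: val_inj.
  - rewrite linearP /=; exact: linl.
  - by rewrite linearP /= !linearP.
  - rewrite raddfB raddfD /= comm; congr (_ + _).
    by case: ifP => _; rewrite -[RHS]/(val _) ?raddf0 // raddfMz.
have rho_vac x n : 0 <= n -> rho x n (mk _ Uvac) = 0.
  by move=> n0; apply: val_inj; rewrite raddf0 /= nprod_vacr.
have [f [[f_lin fvac fE] _]] := univ _ _ _ rho_aff rho_vac.
have V_aff := V_univ.1.
have vac_ann x n : 0 <= n -> nprod (iota x) n vac = 0 by apply: nprod_vacr.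
have [h [_ h_uniq]] := univ V _ vac V_aff vac_ann.
have idE : h = id by apply: h_uniq.
have valfE : h = val \o f.
  apply: h_uniq; split=> [c a b||x n u] /=; last by rewrite fE.
    by rewrite f_lin.
  by rewrite fvac.
have -> : v = val (f v) by rewrite -[val _]/((val \o f) v) -valfE idE.
exact: UP.
Qed.

(** [weight_space] is only a span, so independence of the weights needs a proof. The universal
    property is applied to families in [V] indexed by weight: x_(n) lowers weights by n, so entry d
    of x_(n) f is x_(n) of entry d + n. The resulting map lists the components of a vector, and [Q]
    reads entry 0. *)
Lemma weight_zero_projection : exists2 Q : V -> V, linear Q &
  forall (p : nat) v,
    weight_space (range iota) p v -> Q v = if p == 0%N then v else 0.
Proof.
have [[linl _ comm] univ] := V_univ.
pose rho x n (f : int -> V) : int -> V :=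
  fun d => nprod (iota x) n (f (d + n)).
pose w (d : int) : V := if d == 0 then vac else 0.
have rho_aff : affine_module form k rho.
  split=> [n f c a b|x n c f h|x y m n f]; apply/funext => d.
  - exact: linl.
  - exact: nprod_linearr.
  - rewrite addrfctE opprfctE /rho /= [d + n + m]addrAC comm -addrA.
    rewrite [in RHS]addrfctE; congr (_ + _); case: ifP => [/eqP mn0|_ //].
    (* The central term is taken at entry d + (m + n), which is d here. *)
    by rewrite mn0 addr0 -!scaler_int.
have rho_w x n : 0 <= n -> rho x n w = 0.
  move=> n0; apply/funext => d; rewrite /rho /w; case: ifP => _.
    by rewrite nprod_vacr.
  by rewrite linear0.
have [f [[f_lin fvac fE] _]] := univ _ _ _ rho_aff rho_w.
have f_mono p v : monomial (range iota) p v ->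
    forall d, f v d = if d == p%:Z then v else 0.
  elim=> [d|{}p m _ u [x _ <-] _ IH d]; first by rewrite fvac.
  rewrite fE /rho IH subr_eq addrC -PoszD.
  by case: ifP => // _; rewrite linear0.
exists (fun v => f v 0) => [c a b|p]; first by rewrite f_lin.
apply: lspan_sub => [|v mv] /=; last by rewrite (f_mono p) // eq_sym.
split=> [|c a b /= fa fb].
  by have := f_lin (-1) 0 0; rewrite !scaleN1r !addNr => ->; case: ifP.
have -> : f (c *: a + b) 0 = c *: f a 0 + f b 0 by rewrite f_lin.
by rewrite fa fb; case: ifP => // _; rewrite scaler0 addr0.
Qed.

Lemma weight_space_neg x (q p : nat) v : weight_space (range iota) p v ->
  weight_space (range iota) (q + p) (nprod (iota x) (- q%:Z) v).
Proof.
have sub r := lspan_subspace (monomial (range iota) r).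
apply: (lspan_sub (U := [set v | _ (nprod _ _ v)])) => {v}.
  split=> [|c a b Ua Ub] /=; first by rewrite linear0; case: (sub (q + p)%N).
  by rewrite linearP; apply: (sub _).2.
move=> v mv /=; case: q => [|q]; last first.
  by apply: mem_lspan; apply: monomial_cons => //; exists x.
(* x_(0) is moved through the creation operators to [vac], which it kills; each commutator replaces
   a letter y by [x, y] and has no central term. *)
rewrite add0n oppr0; elim: mv => [|{}p m _ u [y _ <-] mu IH].
  by rewrite nprod_vacr //; case: (sub 0%N).
rewrite affine_commute add0r oppr_eq0 /= addr0.
apply: (subspaceD (sub _)).
  elim: IH => [|c a b ma _ IHb].
    by rewrite linear0; case: (sub (p.+1 + m)%N).
  rewrite linearP; apply: (sub _).2 => //.
  by apply: mem_lspan; apply: monomial_cons => //; exists y.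
by apply: mem_lspan; apply: monomial_cons => //; exists (lbr x y).
Qed.

(** T kills [vac], and moving it past y_(-p-1) leaves the extra term (p+1) y_(-p-2). *)
Lemma weight_space_translation (p : nat) v : weight_space (range iota) p v ->
  weight_space (range iota) p.+1 (nprod v (-2) vac).
Proof.
have sub r := lspan_subspace (monomial (range iota) r).
apply: (lspan_sub (U := [set v | _ (nprod v _ _)])) => {v}.
  split=> [|c a b Ua Ub] /=; first by rewrite nprod0l; case: (sub p.+1).
  by rewrite nprod_linearl; apply: (sub _).2.
move=> v; elim=> [|{}p m _ u [y _ <-] mu IH] /=.
  by rewrite nprod_vac_m2; case: (sub 1%N).
rewrite nprod_derivation -addnS; apply: (subspaceB (sub _)).
  exact: weight_space_neg.
apply: (subspaceMz (sub _)).
rewrite -opprD -PoszD addn1 addnS -addSn.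
by apply: weight_space_neg; apply: mem_lspan.
Qed.

Lemma positive_part_neg x n v : n <= 0 -> positive_part (range iota) v ->
  positive_part (range iota) (nprod (iota x) n v).
Proof.
move=> n0; set P := positive_part _.
have P_sub : subspace P := lspan_subspace _.
apply: (lspan_sub (U := [set v | P (nprod _ _ v)])) => {v}.
  split=> [|c a b Ua Ub] /=; first by rewrite linear0; case: P_sub.
  by rewrite linearP; apply: P_sub.2.
move=> v [p wv] /=; apply: mem_lspan; exists (`|n| + p)%N.
by have := weight_space_neg x `|n|%N wv; rewrite addnS abszE ler0_norm ?opprK.
Qed.

Lemma positive_part_translation v : positive_part (range iota) v ->
  positive_part (range iota) (nprod v (-2) vac).
Proof.
set P := positive_part _; have P_sub : subspace P := lspan_subspace _.
apply: (lspan_sub (U := [set v | P (nprod v _ _)])) => {v}.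
  split=> [|c a b Ua Ub] /=; first by rewrite nprod0l; case: P_sub.
  by rewrite nprod_linearl; apply: P_sub.2.
move=> v [p wv] /=; apply: mem_lspan; exists p.+1.
exact: weight_space_translation.
Qed.

(* Restricting to operators that do not lower the weight makes positivity of
   the weights immediate; stability under the others is [descendant_iota]. *)
Inductive descendant (s : V) : set V :=
| descendant_self : descendant s s
| descendant0 : descendant s 0
| descendantZD (c : F) u v :
    descendant s u -> descendant s v -> descendant s (c *: u + v)
| descendant_neg x n u :
    n <= 0 -> descendant s u -> descendant s (nprod (iota x) n u)
| descendant_translation u :
    descendant s u -> descendant s (nprod u (-2) vac).

Section Singular.
Variable s : V.
Hypothesis s_sing : forall x n, 1 <= n -> nprod (iota x) n s = 0.

Lemma descendant_subspace : subspace (descendant s).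
Proof. by split; [apply: descendant0|apply: descendantZD]. Qed.
Let D_sub := descendant_subspace.

(** Induction on the descendant for all x and n at once: commutators with y_(m) and with T produce
    only modes on, or multiples of, the smaller vector. *)
Lemma descendant_iota x n u :
  descendant s u -> descendant s (nprod (iota x) n u).
Proof.
move=> Du; elim: Du x n => {u} [||c u v _ IHu _ IHv|y m u m0 Du IH|u _ IH] x n.
- have [n0|n0] := lerP n 0; last by rewrite s_sing //; apply: descendant0.
  by apply: descendant_neg => //; apply: descendant_self.
- by rewrite linear0; apply: descendant0.
- by rewrite linearP; apply: descendantZD; [apply: IHu|apply: IHv].
- rewrite affine_commute; apply: (subspaceD D_sub).
    by apply: (subspaceD D_sub); [apply: descendant_neg|apply: IH].
  case: ifP => _; last exact: descendant0.
  by apply: (subspaceMz D_sub); apply: (subspaceZ D_sub).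
- rewrite -[nprod _ _ _](subrK (nprod (iota x) (n - 1) u *~ n)).
  rewrite -nprod_derivation; apply: (subspaceD D_sub).
    exact/descendant_translation/IH.
  by apply: (subspaceMz D_sub).
Qed.

(** The vectors all of whose modes preserve the descendants include [vac] and, by
    [nprod_iterate_closed], are stable under every x_(n); [affine_ind] then yields all of [V]. *)
Lemma descendant_va_ideal : va_ideal (descendant s).
Proof.
apply: left_ideal_va_ideal => // [|a]; first exact: descendant_translation.
pose U :=
  [set a : V | forall n u, descendant s u -> descendant s (nprod a n u)].
apply: (affine_ind (U := U)) => [|n u Du|x m b Ub].
- split=> [n u Du|c b d Ub Ud n u Du].
    by rewrite nprod0l; apply: descendant0.
  by rewrite nprod_linearl; apply: descendantZD; [apply: Ub|apply: Ud].
- by rewrite nprod_vacl; case: ifP => // _; apply: descendant0.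
- by apply: nprod_iterate_closed => // n u; apply: descendant_iota.
Qed.

Lemma singular_simple_quotient (L : vertexAlgType F) (pi : V -> L) :
  simple_quotient iota pi -> positive_part (range iota) s -> pi s = 0.
Proof.
move=> [pi_hom pi_surj [vac0 L_simple] gr_ker] s_pos.
have [pi_lin pi_vac _] := pi_hom.
have pi_ideal := va_hom_image_ideal pi_hom pi_surj descendant_va_ideal.
have [|I1] := L_simple _ pi_ideal.
  by apply; exists s => //; apply: descendant_self.
have [u Du pi_u] := I1 vac.
have u_pos : positive_part (range iota) u.
  elim: Du => [//||c v w _ Pv _ Pw|x n v n0 _|v _].
  - exact: lspan0.
  - exact: (lspan_subspace _).2.
  - exact: positive_part_neg.
  - exact: positive_part_translation.
have [Q Q_lin QE] := weight_zero_projection.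
have Q0 : Q 0 = 0 by have := Q_lin (-1) 0 0; rewrite !scaleN1r !addNr.
have Qvac : Q vac = vac by rewrite (QE 0%N) //; apply/mem_lspan/monomial_vac.
have Qu : Q u = 0.
  elim: u_pos => [//|c v w [p /QE Qv] _ Qw].
  by rewrite Q_lin Qv Qw scaler0 addr0.
(* The kernel of [pi] is spanned by homogeneous vectors, so [Q] preserves it; as Q (vac - u) = vac,
   the vacuum of [L] would be 0. *)
have : pi (Q (vac - u)) = 0.
  have pi_vacu : pi (vac - u) = 0.
    have := pi_lin (-1) u vac.
    by rewrite !scaleN1r pi_u pi_vac addNr addrC.
  have := gr_ker _ pi_vacu; elim=> [|c v w [/= pi_v [p /QE Qv]] _ IH].
    by rewrite Q0 (va_hom0 pi_hom).
  rewrite Q_lin pi_lin IH addr0 Qv; case: ifP => _.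
    by rewrite pi_v scaler0.
  by rewrite (va_hom0 pi_hom) scaler0.
rewrite addrC -scaleN1r Q_lin Qu Qvac scaler0 add0r pi_vac => /eqP.
by rewrite (negPf vac0).
Qed.

End Singular.
End Affine.

(** * Orthogonal decomposition along a nondegenerate subspace *)

Section Orthocomplement.
Variables (F : fieldType) (g : lieAlgType F) (B : g -> g -> F).
Variable kk : {vspace g}.
Hypotheses (B_inv : invariant_form B) (B_nondeg : nondegenerate_on B kk).

(** Pairing with a basis of [kk] is injective on [kk] by nondegeneracy, hence onto the row vectors
    by dimension; some x in [kk] thus has the same pairings as y. *)
Lemma orthocomplement_decomp y :
  exists x z, [/\ x \in kk, orthocomplement B kk z & y = x + z].
Proof.
have [B_lin B_sym _] := B_inv.
pose e := vbasis kk.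
pose f y : 'rV[F]_(\dim kk) := \row_i B y (tnth e i).
have f_lin : linear f by move=> c a b; apply/rowP => i; rewrite !mxE B_lin.
pose fL := GRing.isLinear.Build F g _ *:%R f f_lin.
pose fl : {linear g -> 'rV[F]_(\dim kk)} := HB.pack f fL.
have fP z : f z = 0 -> orthocomplement B kk z.
  move=> fz x /coord_vbasis ->; rewrite B_sym.
  elim/big_rec: _ => [|i v _ IH].
    by have := B_lin (-1) 0 0 z; rewrite scaleN1r addNr mulN1r addNr.
  rewrite B_lin IH addr0 B_sym -tnth_nth.
  by have /rowP/(_ i) := fz; rewrite !mxE => ->; rewrite mulr0.
have lfE z : linfun fl z = f z by rewrite lfunE.
have inj : (kk :&: lker (linfun fl))%VS = 0%VS.
  apply/eqP; rewrite -subv0; apply/subvP => x /memv_capP [xk].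
  rewrite memv_ker lfE memv0 => /eqP /fP xo.
  by apply/eqP; apply: B_nondeg.
have surj : (linfun fl @: kk)%VS = fullv.
  apply/eqP; rewrite eqEdim subvf limg_dim_eq // dimvf /dim /= mul1n.
  by [].
have : linfun fl y \in (linfun fl @: kk)%VS by rewrite surj memvf.
case/memv_imgP => x xk; rewrite !lfE => fxy.
exists x, (y - x); split; rewrite ?(addrC x) ?subrK //.
apply: fP; rewrite -scaleN1r addrC f_lin fxy scaleN1r addNr //.
Qed.

End Orthocomplement.

Theorem proposition5p1 (R : realType)
  (* the simple Lie algebra g and its normalized invariant form *)
  (g : lieAlgType R[i]) (form : g -> g -> R[i])
  (g_simple : simple_lie g) (form_norm : normalized_form form)
  (* the subalgebra kk, reductive in g, its center K ord0 and its simple ideals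
     K j, j != ord0; the form is nondegenerate on kk, so that the
     orthocomplement is a complement *)
  (kk : {vspace g}) (kk_sub : is_subalgebra kk)
  (kk_red : reductive_in kk) (kk_nondeg : nondegenerate_on form kk)
  (r : nat) (K : 'I_r.+1 -> {vspace g})
  (K_sub : forall j, is_subalgebra (K j))
  (K_sum : kk = (\sum_j K j)%VS) (K_direct : directv (\sum_j K j))
  (K_center : is_center_of kk (K ord0))
  (K_ideal : forall j, j != ord0 -> is_ideal_of kk (K j))
  (K_simple : forall j, j != ord0 -> simple_lie (sub_lie (K_sub j)))
  (* the level k, the forms (.,.)_j and the levels k_j *)
  (k : R[i])
  (formK : forall j, sub_lie (K_sub j) -> sub_lie (K_sub j) -> R[i])
  (kK : 'I_r.+1 -> R[i])
  (formK0 : forall x y, formK ord0 x y = form (vsval x) (vsval y))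
  (kK0 : kK ord0 = k)
  (formK_norm : forall j, j != ord0 -> normalized_form (@formK j))
  (kKE : forall j, j != ord0 -> forall x y : sub_lie (K_sub j),
     k * form (vsval x) (vsval y) = kK j * formK j x y)
  (* V^k(g) and its simple quotient V_k(g) *)
  (V : vertexAlgType R[i]) (iota : g -> V)
  (V_univ : universal_affine form k iota)
  (L : vertexAlgType R[i]) (pi : V -> L)
  (L_quot : simple_quotient iota pi)
  (* the V^(k_j)(K j) and their tensor product W *)
  (VK : 'I_r.+1 -> vertexAlgType R[i])
  (iotaK : forall j, sub_lie (K_sub j) -> VK j)
  (VK_univ : forall j, universal_affine (@formK j) (kK j) (@iotaK j))
  (W : vertexAlgType R[i]) (tau : (forall j, VK j) -> W)
  (W_tensor : is_tensor tau)
  (* the homomorphism induced by the inclusion of kk in g *)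
  (theta : W -> V) (theta_hom : va_hom theta)
  (thetaE : forall j (x : sub_lie (K_sub j)),
     theta (tensor_in tau (iotaK j x)) = iota (vsval x))
  (* the central element s; s_pos says that s has no component along vac, and
     excludes the elements s + c *: vac, which satisfy the other hypotheses
     whenever s does *)
  (s : W) (s_central : central s) (s_nscalar : forall c : R[i], s <> c *: vac)
  (s_pos : positive_part
     [set w | exists j (x : sub_lie (K_sub j)), w = tensor_in tau (iotaK j x)] s)
  (s_p : forall v, orthocomplement form kk v ->
     forall n : int, 1 <= n -> nprod (theta s) n (iota v) = 0) :
  pi (theta s) = 0 /\
  exists Phi : va_quot [set s] -> L, va_hom Phi /\ exists x, Phi x <> 0.
Proof.
have [pi_hom pi_surj [vac0 _] _] := L_quot.
have [theta_lin theta_vac thetaN] := theta_hom.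
have [pi_lin pi_vac piN] := pi_hom.
have iota_lin := iota_linear V_univ.
have sing x n : 1 <= n -> nprod (iota x) n (theta s) = 0.
  move=> n1; have [a [b [ak /s_p sb ->]]] :=
    orthocomplement_decomp form_norm.1 kk_nondeg x.
  have -> : iota (a + b) = 1 *: iota a + iota b by rewrite -iota_lin scale1r.
  rewrite nprod_linearl scale1r.
  have -> : nprod (iota a) n (theta s) = 0.
    move: ak; rewrite K_sum => /memv_sumP [xs xsK ->].
    apply: (subspace_sum (U := [set v | nprod (iota v) n (theta s) = 0])).
      split=> [|c u v /= u0 v0]; last first.
        by rewrite iota_lin nprod_linearl u0 v0 scaler0 addr0.
      have := iota_lin (-1) 0 0; rewrite !scaleN1r !addNr => /= ->.
      exact: nprod0l.
    move=> j /=.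
    (* [vsproj] retypes the component as an element of the summand, so that [thetaE] applies and
       centrality carries over from [W]. *)
    have -> : xs j = vsval (vsproj (K j) (xs j) : sub_lie (K_sub j)).
      by rewrite /= vsprojK // xsK.
    rewrite -thetaE -thetaN s_central ?(va_hom0 theta_hom) //.
    exact: le_trans n1.
  (* Every term of the sum contains (theta s)_(n+j) b with n + j >= 1, which vanishes by [sb]. *)
  have [N ->] := nprod_skew (theta s) (iota b) n.
  rewrite big1 ?mul0rz ?oppr0 ?addr0 // => j _.
  by rewrite sb ?nprod0l ?mul0rz // ler_wpDr.
have theta_s_pos : positive_part (range iota) (theta s).
  apply: (va_hom_positive_part theta_hom) s_pos => _ [j [x ->]].
  by exists (vsval x); rewrite ?thetaE.
have pi_s := singular_simple_quotient V_univ sing L_quot theta_s_pos.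
split=> //.
have ker_s v : va_ideal_gen [set s] v -> pi (theta v) = 0.
  have f_hom : va_hom (pi \o theta).
    split=> [c a b||a n b] /=;
      by rewrite ?theta_lin ?pi_lin ?theta_vac ?thetaN ?piN.
  by move=> sv; apply: (sv _ (va_hom_ker_ideal f_hom)) => _ ->.
(* Another representative differs from [v] by an element of the ideal, on which pi o theta
   vanishes. *)
have PhiE v : pi (theta (va_quot_repr (va_pi [set s] v))) = pi (theta v).
  have /va_piP/ker_s :
      va_pi [set s] (va_quot_repr (va_pi [set s] v)) = va_pi [set s] v.
    exact: va_quot_reprK.
  rewrite addrC -scaleN1r theta_lin pi_lin scaleN1r addrC => /eqP.
  by rewrite subr_eq0 => /eqP.
exists (fun x => pi (theta (va_quot_repr x))); split; last first.
  (* The class of the vacuum goes to the vacuum of [L], nonzero by simplicity. *)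
  by exists (va_pi _ vac); rewrite PhiE theta_vac pi_vac; apply/eqP.
split=> [c x y||x n y].
- have [u <-] := va_pi_surj x; have [v <-] := va_pi_surj y.
  by rewrite -linearP !PhiE theta_lin pi_lin.
- by rewrite PhiE theta_vac.
- have [u <-] := va_pi_surj x; have [v <-] := va_pi_surj y.
  by rewrite -[nprod _ _ _]va_pi_nprod !PhiE thetaN piN.
Qed.
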